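(* For each positive integer $n$ the number $\varepsilon_n=\cos\frac{2\pi}{n}+i\sin\frac{2\pi}{n}$ can be obtained on the complex calculator in such a way that all the roots extracted have degrees strictly less than $n$.
   Context: A complex number $x$ can be obtained on the complex calculator if there is a finite sequence of complex numbers ending with $x$, each term of which is either $1$, or the sum, difference, product or quotient (with nonzero divisor) of two earlier terms, or any one of the complex $m$-th roots of an earlier term for some positive integer $m$ (i.e. a complex number whose $m$-th power is an earlier term); in the last case one says that a root of degree $m$ is extracted. The claim is that such a sequence ending in $\varepsilon_n$ exists in which every root extracted has degree $m<n$. *)

(* Defs.v *)
From mathcomp Require Import all_boot all_order all_algebra.
From mathcomp Require Import complex.
From mathcomp Require Import reals trigo.

Set Implicit Arguments.
Unset Strict Implicit.
Unset Printing Implicit Defensive.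

Import Order.TTheory GRing.Theory Num.Theory.
Local Open Scope ring_scope.

(* [s] lists the terms already obtained, [x] is the next one, and [D] is the
   set of allowed degrees.  A root is relational: [x] may be any of the m-th
   roots of [y].  As in "two earlier terms" of a sequence, [y] and [z] need
   not be distinct. *)
Definition calc_step (F : fieldType) (D : pred nat) (s : seq F) (x : F) : Prop :=
  [\/ x = 1,
      exists y z, [/\ y \in s, z \in s &
        [\/ x = y + z, x = y - z, x = y * z | z != 0 /\ x = y / z]]
    | exists m y, [/\ (0 < m)%N, D m, y \in s & x ^+ m = y]].

Definition calc_seq (F : fieldType) (D : pred nat) (s : seq F) : Prop :=
  forall i, (i < size s)%N -> calc_step D (take i s) s`_i.

(* [obtainable predT x] is obtainability with no restriction on the degrees. *)
Definition obtainable (F : fieldType) (D : pred nat) (x : F) : Prop :=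
  exists s : seq F, calc_seq D (rcons s x).

Definition eps (R : realType) (n : nat) : R[i] :=
  (cos (2 * pi / n%:R) +i* sin (2 * pi / n%:R))%C.

(* Main.v *)
Require Import Defs.
From mathcomp Require Import all_boot all_order all_algebra.
From mathcomp Require Import complex.
From mathcomp Require Import reals trigo.
From mathcomp Require Import cyclic finfield.

Set Implicit Arguments.
Unset Strict Implicit.
Unset Printing Implicit Defensive.

Import Order.TTheory GRing.Theory Num.Theory.
Local Open Scope ring_scope.

(** The proof is by strong induction on n, starting from eps_1 = 1.  If
n = a b with 1 < a, b < n, then eps_n is an a-th root of eps_b
([eps_expM]).  If n = p is prime, write
q = p - 1; by induction w = eps_q, a primitive q-th root of unity, is already
available using degrees below q.  With z = eps_p, and chi_k the multiplicative
character of 'F_p that sends a fixed generator to w^k, consider the Gauss sums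
(Lagrange resolvents)

  T_k = sum over a in 'F_p of chi_k(a) z^a,  for 0 <= k < q.

Expanding T_k^q and collecting the powers of z gives
T_k^q = sum over c of f(c) z^c, where every f(c) is a polynomial in w with
integer coefficients and f(t c) = chi_k(t)^q f(c) = f(c) for t <> 0
([gauss_sum_exp]).  So f is constant on nonzero residues, and since the powers
of z add up to 0, T_k^q = f(0) - f(1).  Hence T_k is a q-th root of an
obtainable number ([gauss_sum_obtainable]).  By orthogonality of characters
the T_k add up to q z ([mult_char_sum]), so that z is obtainable with roots of
degree at most q < p ([obtainable_prime_unity_root]).

Any of the q-th roots may be extracted, so each T_k is obtained directly from
its own q-th power. *)

(** * Closure properties of obtainable numbers *)

Section Closure.
Variables (K : fieldType) (D : pred nat).
Implicit Types (s t : seq K) (x y : K).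

Lemma calc_step_sub s t x :
  {subset s <= t} -> calc_step D s x -> calc_step D t x.
Proof.
move=> st [->|[y [z [ys zs h]]]|[m [y [m0 Dm ys h]]]].
- exact: Or31.
- by apply: Or32; exists y, z; split; [exact: st | exact: st |].
- by apply: Or33; exists m, y; split=> //; exact: st.
Qed.

Lemma calc_seq_cat s t : calc_seq D s -> calc_seq D t -> calc_seq D (s ++ t).
Proof.
move=> hs ht i; rewrite size_cat => i_lt; rewrite nth_cat take_cat.
case: ltnP => [/hs //|le_si].
apply: (@calc_step_sub (take (i - size s) t)).
  by move=> x xt; rewrite mem_cat xt orbT.
by apply: ht; rewrite ltn_subLR.
Qed.

Lemma calc_seq_rcons s x :
  calc_seq D s -> calc_step D s x -> calc_seq D (rcons s x).
Proof.
move=> hs hx i; rewrite size_rcons ltnS nth_rcons leq_eqVlt => /orP[/eqP->|lt_is].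
  by rewrite ltnn eqxx -cats1 take_size_cat.
by rewrite lt_is -cats1 takel_cat ?(ltnW lt_is) //; exact: hs.
Qed.

Lemma obtainable1 : obtainable D (1 : K).
Proof. by exists [::]; apply: calc_seq_rcons => //; exact: Or31. Qed.

Lemma obtainable_op x y z :
    obtainable D x -> obtainable D y ->
    [\/ z = x + y, z = x - y, z = x * y | y != 0 /\ z = x / y] ->
  obtainable D z.
Proof.
move=> [s hs] [t ht] hz; exists (rcons s x ++ rcons t y).
apply: calc_seq_rcons; first exact: calc_seq_cat.
apply: Or32; exists x, y; split=> //.
  by rewrite mem_cat mem_rcons mem_head.
by rewrite mem_cat !mem_rcons mem_head orbT.
Qed.

Lemma obtainableD x y :
  obtainable D x -> obtainable D y -> obtainable D (x + y).
Proof. by move=> hx hy; apply: (obtainable_op hx hy); exact: Or41. Qed.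

Lemma obtainableB x y :
  obtainable D x -> obtainable D y -> obtainable D (x - y).
Proof. by move=> hx hy; apply: (obtainable_op hx hy); exact: Or42. Qed.

Lemma obtainableM x y :
  obtainable D x -> obtainable D y -> obtainable D (x * y).
Proof. by move=> hx hy; apply: (obtainable_op hx hy); exact: Or43. Qed.

Lemma obtainable_div x y :
  y != 0 -> obtainable D x -> obtainable D y -> obtainable D (x / y).
Proof. by move=> y0 hx hy; apply: (obtainable_op hx hy); exact: Or44. Qed.

(** The form in which roots are used: a number is obtainable as soon as one of
its powers of allowed degree is. *)
Lemma obtainable_root m x :
  (0 < m)%N -> D m -> obtainable D (x ^+ m) -> obtainable D x.
Proof.
move=> m0 Dm [s hs]; exists (rcons s (x ^+ m)); apply: calc_seq_rcons => //.
by apply: Or33; exists m, (x ^+ m); split=> //; rewrite mem_rcons mem_head.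
Qed.

Lemma obtainable0 : obtainable D (0 : K).
Proof. by rewrite -(subrr 1); apply: obtainableB; exact: obtainable1. Qed.

Lemma obtainable_sum (I : finType) (f : I -> K) :
  (forall i, obtainable D (f i)) -> obtainable D (\sum_i f i).
Proof.
move=> hf; apply: big_ind => //; first exact: obtainable0.
exact: obtainableD.
Qed.

Lemma obtainable_exp x n : obtainable D x -> obtainable D (x ^+ n).
Proof.
move=> hx; elim: n => [|n IHn]; first by rewrite expr0; exact: obtainable1.
by rewrite exprS; exact: obtainableM.
Qed.

Lemma obtainable_nat n : obtainable D (n%:R : K).
Proof.
elim: n => [|n IHn]; first exact: obtainable0.
by rewrite -addn1 natrD; apply: obtainableD => //; exact: obtainable1.
Qed.

End Closure.

Lemma obtainable_sub (K : fieldType) (D D' : pred nat) (x : K) :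
  (forall m, D m -> D' m) -> obtainable D x -> obtainable D' x.
Proof.
move=> DD' [s hs]; exists s => i /hs [->|?|[m [y [m0 Dm ys h]]]].
- exact: Or31.
- exact: Or32.
- by apply: Or33; exists m, y; split=> //; exact: DD'.
Qed.

(** * Powers of Gauss sums *)

Section GaussSum.
Variables (F : finFieldType) (K : fieldType) (D : pred nat).
Variables (chi psi : F -> K).

Definition gauss_sum := \sum_a chi a * psi a.

Hypothesis chiM : {morph chi : a b / a * b}.
Hypothesis psi0 : psi 0 = 1.
Hypothesis psiD : forall a b, psi (a + b) = psi a * psi b.
Hypothesis chi_obt : forall a, obtainable D (chi a).

(** The coefficients f are the m-fold additive convolution of chi with itself.
Convolving with chi preserves obtainability of the values, and it turns
homogeneity of weight chi^m into weight chi^(m+1), by the substitution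
a = t b in the convolution. *)
Lemma gauss_sum_exp m : exists f : F -> K,
  [/\ forall c, obtainable D (f c),
      forall t c, t != 0 -> f (t * c) = chi t ^+ m * f c
    & gauss_sum ^+ m = \sum_c f c * psi c].
Proof.
elim: m => [|m [f [f_obt f_hom f_sum]]].
  (* The unit of convolution. *)
  exists (fun c => (c == 0)%:R); split.
  - by move=> c; exact: obtainable_nat.
  - by move=> t c t0; rewrite expr0 mul1r mulf_eq0 (negPf t0).
  rewrite expr0 (bigD1 0) //= eqxx psi0 mulr1 big1 ?addr0 // => c c0.
  by rewrite (negPf c0) mul0r.
exists (fun c => \sum_a chi a * f (c - a)); split.
- move=> c; apply: obtainable_sum => a.
  by apply: obtainableM; [exact: chi_obt | exact: f_obt].
- move=> t c t0.
  rewrite (reindex (fun b => t * b)) /=; last first.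
    exists (fun b => t^-1 * b) => b _; first by rewrite mulKf.
    by rewrite mulVKf.
  rewrite big_distrr /=; apply: eq_bigr => b _.
  by rewrite chiM -mulrBr f_hom // exprS mulrACA.
rewrite exprS f_sum /gauss_sum big_distrl /=.
under [RHS]eq_bigr => c _ do rewrite big_distrl /=.
rewrite exchange_big /=; apply: eq_bigr => a _.
rewrite big_distrr /= (reindex (fun c => c - a)) /=; last first.
  by exists (fun c => c + a) => c _; rewrite ?subrK ?addrK.
apply: eq_bigr => c _.
by rewrite mulrACA -psiD [a + _]addrC subrK.
Qed.

(** When chi^q is trivial, the coefficients of the q-th power are constant on
nonzero elements, and the relation between the values of psi leaves only the
difference of two coefficients. *)
Lemma gauss_sum_obtainable q :
    (0 < q)%N -> D q -> (forall a, a != 0 -> chi a ^+ q = 1) ->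
    \sum_a psi a = 0 ->
  obtainable D gauss_sum.
Proof.
move=> q0 Dq chiq sum_psi; apply: (obtainable_root q0 Dq).
have [f [f_obt f_hom ->]] := gauss_sum_exp q.
have f_cst c : c != 0 -> f c = f 1.
  by move=> c0; rewrite -{1}(mulr1 c) f_hom // chiq // mul1r.
suff -> : \sum_c f c * psi c = f 0 - f 1 by exact: obtainableB.
move/eqP: sum_psi; rewrite (bigD1 0) //= psi0 addrC addr_eq0 => /eqP sum_psi.
rewrite (bigD1 0) //= psi0 mulr1 -(mulrN1 (f 1)) -sum_psi big_distrr /=.
by congr (_ + _); apply: eq_bigr => c /f_cst ->.
Qed.

End GaussSum.

(** * Multiplicative characters of a finite field *)

Section Characters.
Variables (F : finFieldType) (K : fieldType) (g : F).
Let q := #|F|.-1.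
Hypothesis g_prim : q.-primitive_root g.

(** Discrete logarithm to the base g; it takes the junk value q at 0. *)
Definition dlog (a : F) : nat := find (fun i => g ^+ i == a) (iota 0 q).

Lemma dlogP a : a != 0 -> (dlog a < q)%N /\ g ^+ dlog a = a.
Proof.
move=> a0.
have aq : a ^+ q = 1.
  by apply: (mulfI a0); rewrite -exprS mulr1 prednK ?expf_card //; apply/card_gt0P; exists 0.
have [i a_i] := prim_rootP g_prim aq.
have has_a : has (fun i => g ^+ i == a) (iota 0 q).
  by apply/hasP; exists (i : nat); rewrite ?mem_iota ?ltn_ord // -a_i.
have lt_q : (dlog a < q)%N by rewrite -[X in (_ < X)%N](size_iota 0) -has_find.
by split=> //; have /eqP := nth_find 0%N has_a; rewrite nth_iota // add0n.
Qed.

Definition mult_char (w : K) (a : F) : K :=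
  if a == 0 then 0 else w ^+ dlog a.

Lemma mult_charM w : w ^+ q = 1 -> {morph mult_char w : a b / a * b}.
Proof.
move=> wq a b; rewrite /mult_char mulf_eq0.
case: eqP => [_|/eqP a0]; first by rewrite mul0r.
case: eqP => [_|/eqP b0]; first by rewrite mulr0.
rewrite -exprD -(expr_mod _ wq) -(expr_mod (_ + _) wq).
congr (_ ^+ _); apply/eqP; rewrite -(eq_prim_root_expr g_prim) exprD.
have [_ ->] := dlogP a0; have [_ ->] := dlogP b0.
by have [_ ->] := dlogP (mulf_neq0 a0 b0).
Qed.

Lemma mult_char_order w a : w ^+ q = 1 -> a != 0 -> mult_char w a ^+ q = 1.
Proof. by move=> wq a0; rewrite /mult_char (negPf a0) exprAC wq expr1n. Qed.

(** Orthogonality of characters: for a nonzero, the sum is geometric with ratio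
w^(dlog a), a q-th root of unity that equals 1 only for a = 1. *)
Lemma mult_char_sum w a : q.-primitive_root w ->
  \sum_(k < q) mult_char (w ^+ k) a = if a == 1 then q%:R else 0.
Proof.
move=> w_prim; rewrite /mult_char.
case: (eqVneq a 0) => [->|a0]; first by rewrite eq_sym oner_eq0 big1.
have [lt_q g_a] := dlogP a0.
under eq_bigr => k _ do rewrite exprAC.
case: eqP => [a1|a1].
  suff -> : w ^+ dlog a = 1.
    by under eq_bigr do rewrite expr1n; rewrite sumr_const card_ord.
  by apply/eqP; rewrite -(prim_order_dvd w_prim) (prim_order_dvd g_prim) g_a a1.
have wa1 : w ^+ dlog a - 1 != 0.
  rewrite subr_eq0 -(prim_order_dvd w_prim) (prim_order_dvd g_prim) g_a.
  exact/eqP.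
apply: (mulfI wa1); rewrite -subrX1 mulr0 exprAC (prim_expr_order w_prim).
by rewrite expr1n subrr.
Qed.

End Characters.

Lemma finField_prim_root (F : finFieldType) :
  exists g : F, #|F|.-1.-primitive_root g.
Proof.
have sz : size (enum [pred x : F | x != 0]) = #|F|.-1.
  rewrite -cardE; have := cardC1 (0 : F) => <-.
  by apply: eq_card => x; rewrite !inE.
have F1 := finNzRing_gt1 F.
suff /hasP[g _ g_prim] : has #|F|.-1.-primitive_root (enum [pred x : F | x != 0]).
  by exists g.
apply: has_prim_root; rewrite ?enum_uniq ?sz //; first by rewrite -ltnS prednK // ltnW.
apply/allP => x; rewrite mem_enum inE => x0; rewrite unity_rootE; apply/eqP.
by apply: (mulfI x0); rewrite -exprS mulr1 prednK ?expf_card // ltnW.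
Qed.

(** * Roots of unity of prime order *)

(** The Gauss sums of the p - 1 characters add up to (p - 1) z, because
summing over the characters first kills every term except that of a = 1. *)
Lemma obtainable_prime_unity_root (K : fieldType) (D : pred nat) p (w z : K) :
    prime p -> p.-1.-primitive_root w -> z ^+ p = 1 -> z != 1 ->
    D p.-1 -> obtainable D w ->
  obtainable D z.
Proof.
move=> p_pr w_prim zp z1 Dq w_obt.
have q0 : (0 < p.-1)%N := prim_order_gt0 w_prim.
have cardF := card_Fp p_pr.
have [g] := finField_prim_root 'F_p.
have w_primF : #|'F_p|.-1.-primitive_root w by rewrite cardF.
move=> g_prim.
pose psi (a : 'F_p) := z ^+ a.
have psi0 : psi 0 = 1 by rewrite /psi expr0.
have psiD a b : psi (a + b) = psi a * psi b.
  rewrite /psi -exprD -(expr_mod (a + b)%N zp); congr (_ ^+ _).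
  by rewrite -[in RHS](val_Fp_nat p_pr) natrD !natr_Zp.
have psi1 : psi 1 = z.
  by rewrite /psi -[X in nat_of_ord X]/(1%:R) val_Fp_nat // modn_small ?prime_gt1.
have sum_psi : \sum_a psi a = 0.
  (* Translating the summation index by 1 multiplies the sum by z. *)
  have : \sum_a psi a = z * \sum_a psi a.
    rewrite {1}(reindex (fun a : 'F_p => 1 + a)) /=; last first.
      by exists (fun a => a - 1) => a _; rewrite addrC ?addKr ?subrK // addrK.
    by rewrite big_distrr; apply: eq_bigr => a _; rewrite psiD psi1.
  move/eqP; rewrite -subr_eq0 -{1}(mul1r (\sum_a _)) -mulrBl mulf_eq0 subr_eq0.
  by rewrite eq_sym (negPf z1) => /eqP.
pose T k := gauss_sum (mult_char g (w ^+ k)) psi.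
have wk1 k : (w ^+ k) ^+ #|'F_p|.-1 = 1.
  by rewrite exprAC (prim_expr_order w_primF) expr1n.
have T_obt k : obtainable D (T k).
  have chi_obt a : obtainable D (mult_char g (w ^+ k) a).
    rewrite /mult_char; case: eqP => _; first exact: obtainable0.
    by do 2!apply: obtainable_exp.
  have chi_ord a (a0 : a != 0) := mult_char_order g (wk1 k) a0.
  have chiM := mult_charM g_prim (wk1 k).
  rewrite cardF in chi_ord.
  exact: (gauss_sum_obtainable chiM psi0 psiD chi_obt q0 Dq chi_ord sum_psi).
have sumT : \sum_(k < #|'F_p|.-1) T k = (p.-1)%:R * z.
  rewrite exchange_big /= (bigD1 1) //= -big_distrl /= mult_char_sum // eqxx.
  rewrite psi1 big1 ?addr0 => [|a a1]; first by rewrite cardF.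
  by rewrite -big_distrl /= mult_char_sum // (negPf a1) mul0r.
have qK0 := prim_root_natf_neq0 w_prim.
rewrite -(mulKf qK0 z) mulrC -sumT.
apply: obtainable_div => //; last exact: obtainable_nat.
exact: obtainable_sum.
Qed.

(** * The numbers cos(2 pi / n) + i sin(2 pi / n) *)

Section Eps.
Variable R : realType.

Lemma cis_exp (x : R) k :
  (cos x +i* sin x)%C ^+ k = (cos (k%:R * x) +i* sin (k%:R * x))%C.
Proof.
elim: k => [|k IHk]; first by rewrite expr0 mul0r cos0 sin0.
rewrite exprS IHk -addn1 natrD mulrDl mul1r [_ + x]addrC cosD sinD.
by apply/eqP; rewrite eq_complex /= eqxx /= [cos x * sin _ + _]addrC eqxx.
Qed.

Lemma eps_expM a b : (0 < a)%N -> eps R (a * b) ^+ a = eps R b.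
Proof.
move=> a0; rewrite /eps cis_exp.
suff -> : a%:R * (2 * pi / (a * b)%:R) = 2 * pi / b%:R :> R by [].
have aR0 : a%:R != 0 :> R by rewrite pnatr_eq0 -lt0n.
by rewrite natrM invfM mulrCA mulVKf.
Qed.

Lemma eps1 : eps R 1 = 1.
Proof. by rewrite /eps divr1 mulr_natl cos2pi sin2pi. Qed.

(** With y = k pi / n in ]0, pi[, the real part of the power is
cos(2 y) = 1 - 2 sin(y)^2 < 1. *)
Lemma eps_exp_neq1 n k : (0 < k < n)%N -> eps R n ^+ k != 1.
Proof.
move=> /andP[k0 kn]; rewrite /eps cis_exp.
have n0 : 0 < n%:R :> R by rewrite ltr0n (leq_trans _ kn).
set y : R := k%:R / n%:R * pi.
have -> : k%:R * (2 * pi / n%:R) = y *+ 2.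
  rewrite -[RHS]mulr_natl /y [LHS]mulrC -!mulrA; congr (_ * _).
  by rewrite mulrC -mulrA mulrCA.
have y_pi : 0 < y < pi.
  rewrite /y mulr_gt0 ?divr_gt0 ?pi_gt0 ?n0 ?ltr0n //=.
  by rewrite gtr_pMl ?pi_gt0 // ltr_pdivrMr // mul1r ltr_nat.
have siny := sin_gt0_pi y_pi.
rewrite eq_complex /= negb_and cos_mulr2n cos2sin2; apply/orP; left.
rewrite subr_eq -mulr2n eqrMn2r /= lt_eqF // gtrBl.
by rewrite exprn_gt0.
Qed.

Lemma eps_prim n : (0 < n)%N -> n.-primitive_root (eps R n).
Proof.
move=> n0; rewrite /primitive_root_of_unity n0; apply/forallP => i.
rewrite unity_rootE; have := ltn_ord i; rewrite leq_eqVlt => /orP[/eqP ->|lt_in].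
  by have := eps_expM 1 n0; rewrite muln1 eps1 => ->; rewrite !eqxx.
by rewrite (negPf (eps_exp_neq1 _)) ?(ltn_eqF lt_in).
Qed.

End Eps.

(** * Obtaining the roots of unity *)

Theorem mainTheorem6 (R : realType) (n : nat) (hn : (0 < n)%N) :
  obtainable (fun m : nat => (m < n)%N) (eps R n).
Proof.
elim/ltn_ind: n hn => n IHn n0.
have [n1|n1|->] := ltngtP n 1; first by case: n n0 n1 {IHn}.
  have IH m : (0 < m < n)%N -> obtainable (fun k : nat => (k < n)%N) (eps R m).
    case/andP=> m0 mn; apply: obtainable_sub (IHn m mn m0) => k km.
    exact: ltn_trans mn.
  case: (boolP (prime n)) => [n_pr|/primePn[|[d /andP[d1 dn] /dvdnP[a def_n]]]].
  - have q0 : (0 < n.-1)%N by rewrite -ltnS prednK.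
    have qn : (n.-1 < n)%N by rewrite prednK.
    apply: (obtainable_prime_unity_root n_pr (eps_prim R q0)) => //.
    + exact: prim_expr_order (eps_prim R n0).
    + by rewrite -[eps R n]expr1 eps_exp_neq1 ?n1.
    + by apply: IH; rewrite q0.
  - by rewrite ltnNge n1.
  have d0 := ltnW d1.
  have a0 : (0 < a)%N by move: n0; rewrite def_n muln_gt0 => /andP[].
  apply: (@obtainable_root _ _ a); rewrite // ?def_n ?ltn_Pmulr //.
  by rewrite eps_expM // -def_n; apply: IH; rewrite d0.
by rewrite eps1; exact: obtainable1.
Qed.
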